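(* Let $(A,X,Y,H_A)$ be jointly distributed random variables, where $H_A=h(A,X,\xi)$ for a measurable map $h$ and a random variable $\xi$ that is conditionally independent of $Y$ given $(A,X)$. Then $Y\to(A,X)\to H_A$ is a Markov chain. The following two conditions are equivalent: $Y$ and $A$ are conditionally independent given $(H_A,X)$; and $I(H_A;Y\mid X)=I(A;Y\mid X)$. Assume that they hold (i.e. $H_A$ is sufficient for predicting $Y$ given $X$). Then $$I(A;H_A\mid X)\ge I(A;Y\mid X).$$ Moreover, equality holds if and only if $I(A;H_A\mid Y,X)=0$.
   Context: $A$ is a random adjacency matrix (symmetric, in $\{0,1\}^{N\times N}$, zero diagonal), $Y$ a random label vector in $[C]^N$ where $[C]=\{1,\dots,C\}$, $X$ a random feature matrix in $\mathbb{R}^{N\times D}$, and $H_A$ a random representation (real matrix). $U\to V\to W$ is a Markov chain when $U$ and $W$ are conditionally independent given $V$. $I(\cdot;\cdot\mid\cdot)$ is conditional mutual information. *)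

(* Defs.v *)
From HB Require Import structures.
From mathcomp Require Import all_boot all_order all_algebra.
From mathcomp Require Import all_classical all_reals all_analysis.

Set Implicit Arguments.
Unset Strict Implicit.
Unset Printing Implicit Defensive.

Import Order.TTheory GRing.Theory Num.Theory.
Import numFieldNormedType.Exports.

Local Open Scope classical_set_scope.
Local Open Scope ring_scope.
Local Open Scope ereal_scope.
Local Open Scope charge_scope.

(* Measurable types are pointed, so the nonempty set of classes is 'I_C.+1. *)
HB.instance Definition _ (n : nat) := isPointed.Build 'I_n.+1 ord0.

Notation discrete T := (g_sigma_algebraType (@discrete_measurable T)).

(* Real matrices with their Borel sigma-algebra. *)
Notation real_matrix R m n := (g_sigma_algebraType (@open 'M[R]_(m, n))).

Notation bool_matrix N := (discrete 'M[bool]_N).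

Notation label_vector N C := (discrete 'rV['I_C.+1]_N).

Definition is_adjacency (N : nat) (M : 'M[bool]_N) : Prop :=
  M^T%R = M /\ forall i, M i i = false.

Section pair_rv.
Context d d1 d2 (T : measurableType d) (T1 : measurableType d1)
  (T2 : measurableType d2) (U : {mfun T >-> T1}) (V : {mfun T >-> T2}).

Definition pair_rv (w : T) : T1 * T2 := (U w, V w).

Let measurable_pair_rv : measurable_fun setT pair_rv.
Proof. by apply: measurable_fun_pair; exact: measurable_funPT. Qed.

HB.instance Definition _ :=
  isMeasurableFun.Build _ _ _ _ pair_rv measurable_pair_rv.

End pair_rv.

Notation "⟨ U , V ⟩" :=
  (pair_rv U V : {mfun _ >-> _}) (at level 0, format "⟨ U ,  V ⟩").

Section conditional_probability.
Context d d' (T : measurableType d) (T' : measurableType d') (R : realType).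
Variables (P : probability T R) (W : {RV P >-> T'}).
Variables (E : set T) (mE : measurable E).

Definition event_law (B : set T') : \bar R := mrestr P mE (W @^-1` B).

Let event_law0 : event_law set0 = 0.
Proof. by rewrite /event_law preimage_set0 measure0. Qed.

Let event_law_ge0 B : 0 <= event_law B.
Proof. exact: measure_ge0. Qed.

Let event_law_sigma_additive : semi_sigma_additive event_law.
Proof.
move=> F mF tF mUF; rewrite /event_law preimage_bigcup.
apply: measure_semi_sigma_additive.
- by move=> n; exact: measurable_funPTI.
- apply/trivIsetP => i j _ _ ij; rewrite -preimage_setI.
  by move/trivIsetP : tF => /(_ _ _ _ _ ij) ->//; rewrite preimage_set0.
- by rewrite -preimage_bigcup; exact: measurable_funPTI.
Qed.

HB.instance Definition _ := isMeasure.Build _ _ _ event_law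
  event_law0 event_law_ge0 event_law_sigma_additive.

Let event_law_fin : fin_num_fun event_law.
Proof. by move=> B mB; apply: fin_num_measure; exact: measurable_funPTI. Qed.

HB.instance Definition _ := Measure_isFinite.Build _ _ _ event_law
  event_law_fin.

(* A version of w |-> P(E | W = w): the density with respect to the law of W of
   the measure B |-> P(E, W \in B), which is dominated by that law. *)
Definition cond_prob : T' -> \bar R :=
  'd (charge_of_finite_measure event_law) '/d (distribution P W).

End conditional_probability.
Arguments cond_prob {d d' T T' R} P W {E} mE.

Section conditional_independence.
Context d dU dV dW (T : measurableType d) (TU : measurableType dU)
  (TV : measurableType dV) (TW : measurableType dW) (R : realType).
Variables (P : probability T R).
Variables (U : {RV P >-> TU}) (V : {RV P >-> TV}) (W : {RV P >-> TW}).

(* P(U \in B, V \in C | W) = P(U \in B | W) P(V \in C | W) almost surely *)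
Definition cond_indep : Prop :=
  forall (B : set TU) (C : set TV) (mB : measurable B) (mC : measurable C),
    let mUB := measurable_funPTI U mB in
    let mVC := measurable_funPTI V mC in
    {ae distribution P W, forall w,
      cond_prob P W (measurableI _ _ mUB mVC) w =
      cond_prob P W mUB w * cond_prob P W mVC w}.

(* The joint law of a triple (U', V', W) such that, given W, U' and V' are
   independent and respectively distributed as U and V, that is the law
   P_W(dw) P_{U|W=w}(du) P_{V|W=w}(dv). *)
Definition is_cond_prod_law (Q : probability (TU * TV * TW)%type R) : Prop :=
  forall (B : set TU) (C : set TV) (D : set TW)
    (mB : measurable B) (mC : measurable C), measurable D ->
    Q (B `*` C `*` D) =
    \int[distribution P W]_(w in D)
      (cond_prob P W (measurable_funPTI U mB) w *
       cond_prob P W (measurable_funPTI V mC) w).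

End conditional_independence.
Arguments cond_indep {d dU dV dW T TU TV TW R} P U V W.
Arguments is_cond_prod_law {d dU dV dW T TU TV TW R} P U V W Q.

Definition markov_chain d dU dV dW (T : measurableType d)
    (TU : measurableType dU) (TV : measurableType dV) (TW : measurableType dW)
    (R : realType) (P : probability T R)
    (U : {RV P >-> TU}) (V : {RV P >-> TV}) (W : {RV P >-> TW}) : Prop :=
  cond_indep P U W V.
Arguments markov_chain {d dU dV dW T TU TV TW R} P U V W.

(* Kullback-Leibler divergence of mu from nu, in nats. *)
Definition kl_div d (T : measurableType d) (R : realType)
    (mu nu : probability T R) : \bar R :=
  if `[< mu `<< nu >] then
    \int[mu]_x lne (('d (charge_of_finite_measure mu) '/d nu) x)
  else +oo.

Section mutual_information.
Context d dU dV dW (T : measurableType d) (TU : measurableType dU)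
  (TV : measurableType dV) (TW : measurableType dW) (R : realType).
Variables (P : probability T R).
Variables (U : {RV P >-> TU}) (V : {RV P >-> TV}) (W : {RV P >-> TW}).

(* is_cond_prod_law is satisfied by at most one law, since measurable boxes
   form a generating pi-system; such a law exists as soon as U or V takes
   values in a standard Borel space (e.g. a finite discrete one). *)
Definition cond_prod_law : probability (TU * TV * TW)%type R :=
  get (is_cond_prod_law P U V W).

(* I(U; V | W) = D(P_{U,V,W} || P_W P_{U|W} P_{V|W}) *)
Definition cond_mutual_info : \bar R :=
  kl_div (distribution P ⟨⟨U, V⟩, W⟩) cond_prod_law.

End mutual_information.
Arguments cond_prod_law {d dU dV dW T TU TV TW R} P U V W.
Arguments cond_mutual_info {d dU dV dW T TU TV TW R} P U V W.

(* Main.v *)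
(* For a finite-valued V, the conditional law of V given W has a density p_v(w)
   with respect to counting measure, so that the conditional product law of
   (U, V, W) is a mixture over v of the laws of (U, v, W) with weights p_v(W),
   and P_(U,V,W) has density P(V = v | U, W) / P(V = v | W) with respect to it.
   Hence I(U; V | W) = H(V | W) - H(V | U, W), a difference of finite
   quantities, even though U and W are arbitrary. By Gibbs' inequality, refining
   the conditioning decreases H, with equality if and only if the conditional
   probabilities agree, that is, if and only if U and V are independent given W.
   Writing every information as a difference of entropies of Y gives the
   equivalence (using H(Y | A, X) = H(Y | H_A, A, X)); writing it as a difference
   of entropies of A gives
   I(A; H_A | X) - I(A; Y | X) = H(A | Y, X) - H(A | H_A, X)
                               = H(A | Y, X) - H(A | H_A, Y, X)
                               = I(A; H_A | Y, X). *)

From HB Require Import structures.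
Require Import Defs.
From mathcomp Require Import all_boot all_order all_algebra.
From mathcomp Require Import all_classical all_reals all_analysis.
From mathcomp Require Import measurable_realfun ring lra.

Set Implicit Arguments.
Unset Strict Implicit.
Unset Printing Implicit Defensive.

Import Order.TTheory GRing.Theory Num.Theory.
Import numFieldNormedType.Exports.

Local Open Scope classical_set_scope.
Local Open Scope ring_scope.
Local Open Scope ereal_scope.
Local Open Scope charge_scope.

(** * Measures with a density *)

(** The proofs [g0] and [ig] are arguments so that the finite measure structure can be inferred from
    the term [mdensity g0 ig]. *)
Definition mdensity d (T : measurableType d) (R : realType)
    (mu : {measure set T -> \bar R}) (g : T -> R)
    (g0 : forall x, (0 <= g x)%R) (ig : mu.-integrable setT (EFin \o g))
    (A : set T) : \bar R := \int[mu]_(x in A) (g x)%:E.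

Section density_measure.
Context d (T : measurableType d) (R : realType).
Variables (mu : {finite_measure set T -> \bar R}) (g : T -> R).
Hypothesis g0 : forall x, (0 <= g x)%R.
Hypothesis ig : mu.-integrable setT (EFin \o g).

Let mg : measurable_fun [set: T] (EFin \o g).
Proof. exact: measurable_int ig. Qed.

Local Notation nu := (mdensity g0 ig).

Let nu0 : nu set0 = 0.
Proof. exact: integral_set0. Qed.

Let nu_ge0 A : 0 <= nu A.
Proof. by apply: integral_ge0 => x _; rewrite lee_fin. Qed.

Let nu_sigma_additive : semi_sigma_additive nu.
Proof.
by apply: semi_sigma_additive_nng_induced => // x; rewrite lee_fin.
Qed.

HB.instance Definition _ := isMeasure.Build _ _ _ nu
  nu0 nu_ge0 nu_sigma_additive.

Let nu_fin : fin_num_fun nu.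
Proof.
by move=> A mA; apply: integrable_fin_num => //; exact: integrableS ig.
Qed.

HB.instance Definition _ := Measure_isFinite.Build _ _ _ nu nu_fin.

Lemma mdensity_dominates : nu `<< mu.
Proof.
apply/null_content_dominatesP => A mA A0.
transitivity (\int[mu]_(x in A) `|(g x)%:E|).
  by apply: eq_integral => x _; rewrite gee0_abs// lee_fin.
by apply: integral_abs_eq0 => //; exact: measurable_funTS.
Qed.

(** The Radon-Nikodym derivative of [nu] agrees with [g] almost everywhere, both having the same
    integral over every measurable set; the change of variables for that derivative then applies. *)
Lemma ge0_integral_mdensity (f : T -> \bar R) :
    measurable_fun setT f -> (forall x, 0 <= f x) ->
  \int[nu]_x f x = \int[mu]_x (f x * (g x)%:E).
Proof.
move=> mf f0; have numu := mdensity_dominates.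
have iD := Radon_Nikodym_SigmaFinite.f_integrable numu.
have D0 := Radon_Nikodym_SigmaFinite.f_ge0 numu.
rewrite -(Radon_Nikodym_SigmaFinite.change_of_variables numu)//.
apply: ge0_ae_eq_integral => //.
- by apply: emeasurable_funM => //; exact: measurable_int iD.
- exact: emeasurable_funM.
- by move=> x _; rewrite mule_ge0.
- by move=> x _; rewrite mule_ge0// lee_fin.
- apply: ae_eqe_mul2l; apply: integral_ae_eq => // A _ mA.
  by rewrite -Radon_Nikodym_SigmaFinite.f_integral.
Qed.

End density_measure.

(** The restriction to [E] is the measure with density the indicator of [E]. *)
Lemma ge0_integral_mrestr d (T : measurableType d) (R : realType)
    (mu : {finite_measure set T -> \bar R}) (E : set T) (mE : measurable E)
    (f : T -> \bar R) : measurable_fun setT f -> (forall x, 0 <= f x) ->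
  \int[mrestr mu mE]_x f x = \int[mu]_(x in E) f x.
Proof.
move=> mf f0.
have iE : mu.-integrable setT (EFin \o \1_E).
  by apply: integrable_indic => //; exact: fin_num_fun_lty.
have E0 x : (0 <= \1_E x :> R)%R by [].
rewrite (eq_measure_integral (mdensity E0 iE)); last first.
  move=> A mA _; rewrite /= /mdensity integral_indic// /mrestr setIC//.
rewrite ge0_integral_mdensity// [RHS]integral_mkcond.
by apply: eq_integral => x _; rewrite epatch_indic.
Qed.

(** * Conditional probabilities *)

Section conditional_probability_version.
Context d d' (T : measurableType d) (T' : measurableType d') (R : realType).
Variables (P : probability T R) (W : {RV P >-> T'}).

Lemma event_law_dominates (E : set T) (mE : measurable E) :
  event_law (P := P) W mE `<< distribution P W.
Proof.
apply/null_content_dominatesP => B mB PB0.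
apply/eqP; rewrite eq_le measure_ge0 andbT -PB0.
rewrite /event_law /mrestr le_measure ?inE//.
- by apply: measurableI => //; exact: measurable_funPTI.
- exact: measurable_funPTI.
Qed.

Lemma cond_prob_integral (E : set T) (mE : measurable E) (B : set T') :
    measurable B ->
  \int[distribution P W]_(w in B) cond_prob P W mE w = P (W @^-1` B `&` E).
Proof.
by move=> mB; rewrite -Radon_Nikodym_integral//; exact: event_law_dominates.
Qed.

Lemma cond_prob_fin_num (E : set T) (mE : measurable E) w :
  cond_prob P W mE w \is a fin_num.
Proof. exact/Radon_Nikodym_fin_num/event_law_dominates. Qed.

Lemma integrable_cond_prob (E : set T) (mE : measurable E) :
  (distribution P W).-integrable setT (cond_prob P W mE).
Proof. exact/Radon_Nikodym_integrable/event_law_dominates. Qed.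

Lemma measurable_cond_prob (E : set T) (mE : measurable E) :
  measurable_fun setT (cond_prob P W mE).
Proof. exact: measurable_int (integrable_cond_prob mE). Qed.

Lemma cond_prob_ge0 (E : set T) (mE : measurable E) :
  {ae distribution P W, forall w, 0 <= cond_prob P W mE w}.
Proof.
have nd := event_law_dominates mE.
apply: filterS (ae_eq_Radon_Nikodym_SigmaFinite nd measurableT) => w.
by rewrite /cond_prob => /(_ I) <-; exact: Radon_Nikodym_SigmaFinite.f_ge0.
Qed.

(** Both sides have the same integral over every measurable set. Combined with nonnegativity for the
    complement, this bounds a conditional probability by 1. *)
Lemma cond_probC (E : set T) (mE : measurable E) :
  {ae distribution P W, forall w,
    cond_prob P W mE w + cond_prob P W (measurableC mE) w = 1}.
Proof.
have h : ae_eq (distribution P W) setT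
    (cond_prob P W mE \+ cond_prob P W (measurableC mE)) (cst 1).
  apply: integral_ae_eq => //.
    by apply: integrableD => //; exact: integrable_cond_prob.
  move=> B _ mB; rewrite integralD//; last 2 first.
  - by apply: integrableS (integrable_cond_prob _).
  - by apply: integrableS (integrable_cond_prob _).
  rewrite !cond_prob_integral// integral_cst// mul1e.
  have mWB : measurable (W @^-1` B) by exact: measurable_funPTI.
  rewrite -measureU//.
  - by rewrite -setIUr setUv setIT.
  - exact: measurableI.
  - by apply: measurableI => //; exact: measurableC.
  - by rewrite setIACA setICr setI0.
by apply: filterS h => w /(_ I).
Qed.

(* cond_prob lies in [0, 1] only almost everywhere; clipping makes these bounds
   hold everywhere. *)
Definition cprob (E : set T) (mE : measurable E) (w : T') : R :=
  (Num.min 1 (Num.max 0 (fine (cond_prob P W mE w))))%R.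

Variables (E : set T) (mE : measurable E).

Lemma cprob_ge0 w : (0 <= cprob mE w)%R.
Proof. by rewrite /cprob le_min ler01 le_max lexx. Qed.

Lemma cprob_le1 w : (cprob mE w <= 1)%R.
Proof. by rewrite /cprob ge_min lexx. Qed.

Lemma measurable_cprob : measurable_fun setT (cprob mE).
Proof.
apply: measurable_minr => //; apply: measurable_maxr => //.
apply: (measurableT_comp (f := fine)); first exact: fine_measurable.
exact: measurable_cond_prob.
Qed.

Lemma cond_prob_cprob :
  {ae distribution P W, forall w, cond_prob P W mE w = (cprob mE w)%:E}.
Proof.
apply: filterS3 (cond_prob_ge0 mE) (cond_prob_ge0 (measurableC mE))
  (cond_probC mE) => w.
rewrite /cprob; have := cond_prob_fin_num mE w.
have := cond_prob_fin_num (measurableC mE) w.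
case: (cond_prob P W mE w) => // r; case: (cond_prob _ _ _ _) => // s _ _.
rewrite !lee_fin => r0 s0 [rs1] /=.
by rewrite max_r// min_r// -rs1 lerDl.
Qed.

Lemma integrable_cprob : P.-integrable setT (EFin \o (cprob mE \o W)).
Proof.
apply: measurable_bounded_integrable => //.
- exact: fin_num_fun_lty.
- by apply: measurableT_comp => //; exact: measurable_cprob.
exists 1%R; split => // M M1 x _ /=; rewrite ger0_norm ?cprob_ge0//.
by rewrite (le_trans (cprob_le1 _))// ltW.
Qed.

(** The defining property of conditional probability, extended from indicators to nonnegative
    functions of [W]. The entropy formulas below come from suitable choices of [g]. *)
Lemma ge0_integral_cprob (g : T' -> \bar R) :
    measurable_fun setT g -> (forall w, 0 <= g w) ->
  \int[P]_(x in E) g (W x) = \int[P]_x (g (W x) * (cprob mE (W x))%:E).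
Proof.
move=> mg g0; have nd := event_law_dominates mE.
have mc := measurable_cprob.
transitivity (\int[event_law (P := P) W mE]_w g w).
  have mgW : measurable_fun setT (g \o W) by exact: measurableT_comp.
  rewrite -(ge0_integral_mrestr P mE mgW); last by move=> x; exact: g0.
  (* By definition [event_law] is the image under [W] of [P] restricted to [E]. *)
  rewrite [RHS](_ : _ = \int[pushforward (mrestr P mE) W]_w g w)//.
  by rewrite ge0_integral_pushforward.
rewrite -(Radon_Nikodym_SigmaFinite.change_of_variables nd)//.
transitivity (\int[distribution P W]_w (g w * (cprob mE w)%:E)).
  apply: ge0_ae_eq_integral => //.
  - apply: emeasurable_funM => //.
    exact: measurable_int (Radon_Nikodym_SigmaFinite.f_integrable _).
  - by apply: emeasurable_funM => //; exact/measurable_EFinP.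
  - by move=> w _; rewrite mule_ge0// Radon_Nikodym_SigmaFinite.f_ge0.
  - by move=> w _; rewrite mule_ge0// lee_fin cprob_ge0.
  - apply: filterS2 cond_prob_cprob
      (ae_eq_Radon_Nikodym_SigmaFinite nd measurableT) => w.
    by rewrite /cond_prob => cE /(_ I) RE _; rewrite RE cE.
rewrite ge0_integral_distribution//.
- by apply: emeasurable_funM => //; exact/measurable_EFinP.
- by move=> w; rewrite mule_ge0// lee_fin cprob_ge0.
Qed.

(** A density is determined almost everywhere by its integrals over measurable sets. This is the
    tool for recognizing a given function as a conditional probability. *)
Lemma cprob_unique (c : T' -> R) :
    measurable_fun setT c -> (forall w, 0 <= c w)%R ->
    (forall B, measurable B ->
      \int[P]_(x in W @^-1` B) (c (W x))%:E = P (W @^-1` B `&` E)) ->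
  {ae distribution P W, forall w, c w = cprob mE w}.
Proof.
move=> mc c0 cE.
have mcE : measurable_fun setT (EFin \o c) by exact/measurable_EFinP.
have intE B : measurable B ->
    \int[distribution P W]_(w in B) (c w)%:E = P (W @^-1` B `&` E).
  move=> mB; rewrite ge0_integral_pushforward//; first exact: cE.
    exact: measurable_funTS.
  by move=> w _; rewrite lee_fin.
have h : ae_eq (distribution P W) setT (cond_prob P W mE) (EFin \o c).
  apply: integral_ae_eq => //; first exact: integrable_cond_prob.
  by move=> B _ mB; rewrite cond_prob_integral// intE.
apply: filterS2 cond_prob_cprob h => w -> /(_ I) /= []//.
Qed.

End conditional_probability_version.
Arguments cprob {d d' T T' R} P W {E} mE w.

(** * Uniqueness of finite measures on products *)

(** Measurable boxes form a generating pi-system; as [m1] is finite, the constant sequence [setT]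
    serves as the exhaustion. *)
Lemma finite_measure_prod_unique d1 d2 (T1 : measurableType d1)
    (T2 : measurableType d2) (R : realType)
    (m1 m2 : {measure set (T1 * T2) -> \bar R}) :
    m1 setT < +oo ->
    (forall A B, measurable A -> measurable B -> m1 (A `*` B) = m2 (A `*` B)) ->
  forall S, measurable S -> m1 S = m2 S.
Proof.
move=> m1oo m12 S mS.
apply: (measure_unique [set A `*` B | A in measurable & B in measurable]
  (fun=> setT)) => //.
- exact: measurable_prod_measurableType.
- move=> _ _ [A mA [B mB <-]] [A' mA' [B' mB' <-]]; rewrite -setXI.
  exists (A `&` A'); first exact: measurableI.
  by exists (B `&` B') => //; exact: measurableI.
- by move=> _; exists setT => //; exists setT => //; rewrite setXTT.
- by rewrite bigcup_const//; exists 0%N.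
- by move=> _ [A mA [B mB <-]]; exact: m12.
Qed.

(** The two-factor case is used twice: once for the outer product, and once, with [C] fixed, for the
    measures sending [S] to the mass of [S] times [C]. *)
Lemma finite_measure_prod3_unique d1 d2 d3 (T1 : measurableType d1)
    (T2 : measurableType d2) (T3 : measurableType d3) (R : realType)
    (m1 m2 : {measure set (T1 * T2 * T3) -> \bar R}) :
    m1 setT < +oo ->
    (forall A B C, measurable A -> measurable B -> measurable C ->
      m1 (A `*` B `*` C) = m2 (A `*` B `*` C)) ->
  forall S, measurable S -> m1 S = m2 S.
Proof.
move=> m1oo m12; apply: finite_measure_prod_unique => // S C mS mC.
have mT : measurable ([set: T1 * T2] `*` C) by exact: measurableX.
have mfst : measurable_fun [set: T1 * T2 * T3] fst by [].
pose n (m : {measure set (T1 * T2 * T3) -> \bar R}) :=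
  pushforward (mrestr m mT) fst.
have nE (m : {measure set (T1 * T2 * T3) -> \bar R}) B :
    n m B = m (B `*` C).
  rewrite /n /pushforward /mrestr; congr (m _).
  by apply/seteqP; split=> -[x y] /=; [move=> [? []]|move=> []].
rewrite -!nE.
apply: (finite_measure_prod_unique (m1 := pushforward (mrestr m1 mT) fst)
  (m2 := pushforward (mrestr m2 mT) fst)) => //.
  apply: le_lt_trans m1oo; rewrite /= /pushforward /mrestr preimage_setT setTI.
  by apply: le_measure; rewrite ?inE.
by move=> A B mA mB; rewrite [LHS]nE [RHS]nE m12.
Qed.

Lemma ae_distribution d d' (T : measurableType d) (T' : measurableType d')
    (R : realType) (P : probability T R) (W : {RV P >-> T'}) (Q : T' -> Prop) :
  {ae distribution P W, forall w, Q w} -> {ae P, forall x, Q (W x)}.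
Proof.
move=> [N [mN N0 QN]]; exists (W @^-1` N); split => //.
  exact: measurable_funPTI.
by move=> x /= Qx; exact: QN.
Qed.

Lemma integral_cprob d d' (T : measurableType d) (T' : measurableType d')
    (R : realType) (P : probability T R) (W : {RV P >-> T'})
    (E : set T) (mE : measurable E) (B : set T') : measurable B ->
  \int[P]_(x in W @^-1` B) (cprob P W mE (W x))%:E = P (W @^-1` B `&` E).
Proof.
move=> mB; have mWB : measurable (W @^-1` B) by exact: measurable_funPTI.
rewrite setIC -[RHS]mul1e -integral_cst; last exact: measurableI.
rewrite [RHS]integral_mkcondr [LHS]integral_mkcond.
transitivity (\int[P]_x ((\1_B (W x))%:E * (cprob P W mE (W x))%:E)).
  by apply: eq_integral => x _; rewrite epatch_indic/= muleC.
rewrite -(ge0_integral_cprob W mE (g := EFin \o \1_B))//.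
- by apply: eq_integral => x _; rewrite epatch_indic/= mul1e.
- exact/measurable_EFinP.
- by move=> w; rewrite lee_fin.
Qed.

(** * Conditioning on a finer variable *)

Section tower.
Context d d' d'' (T : measurableType d) (T' : measurableType d')
  (T'' : measurableType d'') (R : realType).
Variables (P : probability T R) (W : {RV P >-> T'}) (W' : {RV P >-> T''}).
Variables (E : set T) (mE : measurable E).
Hypothesis phi : exists2 f : T'' -> T', measurable_fun setT f &
  forall x, W x = f (W' x).

(** Since [W] is a function of [W'], so is P(E | W); hence it is a version of P(E | W') exactly when
    it has the right integrals over the events of [W']. *)
Lemma cprob_factorP :
  {ae P, forall x, cprob P W' mE (W' x) = cprob P W mE (W x)} <->
  forall S, measurable S ->
    \int[P]_(x in W' @^-1` S) (cprob P W mE (W x))%:E = P (W' @^-1` S `&` E).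
Proof.
have [f mf WE] := phi.
have mc := measurable_cprob W mE; have mc' := measurable_cprob W' mE.
have mcW : measurable_fun setT (EFin \o (cprob P W mE \o W)).
  by apply/measurable_EFinP; exact: measurableT_comp.
have mcW' : measurable_fun setT (EFin \o (cprob P W' mE \o W')).
  by apply/measurable_EFinP; exact: measurableT_comp.
split=> [h S mS|h].
  have mWS : measurable (W' @^-1` S) by exact: measurable_funPTI.
  rewrite -integral_cprob//; apply: ge0_ae_eq_integral => //.
  - exact: measurable_funTS.
  - exact: measurable_funTS.
  - by move=> x _; rewrite lee_fin cprob_ge0.
  - by move=> x _; rewrite lee_fin cprob_ge0.
  - by apply: filterS h => x -> _.
have mcf : measurable_fun setT (cprob P W mE \o f) by exact: measurableT_comp.
have : {ae distribution P W', forall w,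
    (cprob P W mE \o f) w = cprob P W' mE w}.
  apply: cprob_unique => //= [w|S mS]; first exact: cprob_ge0.
  by rewrite -h//; apply: eq_integral => x _; rewrite WE.
by move/ae_distribution; apply: filterS => x /= <-; rewrite WE.
Qed.

End tower.

(** * Conditional independence *)

(** [cond_prob] depends on a proof of measurability, so replacing an event by an equal one needs
    proof irrelevance. *)
Lemma cond_prob_irr d d' (T : measurableType d) (T' : measurableType d')
    (R : realType) (P : probability T R) (W : {RV P >-> T'})
    (E F : set T) (mE : measurable E) (mF : measurable F) :
  E = F -> cond_prob P W mE = cond_prob P W mF.
Proof.
by move=> EF; subst F; congr cond_prob; exact: Prop_irrelevance.
Qed.

Section conditional_independence_characterization.
Context d dU dV dW (T : measurableType d) (TU : measurableType dU)
  (TV : measurableType dV) (TW : measurableType dW) (R : realType).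
Variables (P : probability T R).
Variables (U : {RV P >-> TU}) (V : {RV P >-> TV}) (W : {RV P >-> TW}).

Lemma cond_indep_sym : cond_indep P U V W -> cond_indep P V U W.
Proof.
move=> UVW C B mC mB /=; apply: filterS (UVW B C mB mC) => w.
rewrite muleC => <-; congr (_ w); apply: cond_prob_irr.
by rewrite setIC.
Qed.

Lemma pair_rv_snd : exists2 f : TU * TW -> TW, measurable_fun setT f &
  forall x, W x = f (⟨U, W⟩ x).
Proof. by exists snd. Qed.

(** Apply [ge0_integral_cprob] to the event that [U] lies in [B], with [g] the product of P(E | W)
    and the indicator of [D]. This ties integrals over boxes to products of conditional
    probabilities. *)
Lemma integral_cprob_box (B : set TU) (D : set TW) (E : set T)
    (mB : measurable B) (mD : measurable D) (mE : measurable E) :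
  \int[P]_(x in ⟨U, W⟩ @^-1` (B `*` D)) (cprob P W mE (W x))%:E =
  \int[P]_(x in W @^-1` D)
    (cprob P W (measurable_funPTI U mB) (W x) * cprob P W mE (W x))%:E.
Proof.
have -> : ⟨U, W⟩ @^-1` (B `*` D) = U @^-1` B `&` W @^-1` D by [].
rewrite integral_mkcondr [RHS]integral_mkcond.
have mc := measurable_cprob W mE.
pose g : TW -> \bar R := (EFin \o cprob P W mE) \* (EFin \o \1_D).
transitivity (\int[P]_(x in U @^-1` B) g (W x)).
  by apply: (eq_integral (g \o W)) => x _; rewrite epatch_indic.
rewrite (ge0_integral_cprob W (measurable_funPTI U mB)) /g.
- apply: eq_integral => x _; rewrite epatch_indic/= muleAC EFinM.
  by congr (_ * _); rewrite muleC.
- by apply: emeasurable_funM; exact/measurable_EFinP.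
- by move=> w /=; rewrite mule_ge0// lee_fin ?cprob_ge0.
Qed.

(** By [cprob_factorP], the right-hand side is an identity between integrals over all events of (U,
    W). It suffices to check it on boxes, where [integral_cprob_box] turns it into the product
    formula. *)
Lemma cond_indepP : cond_indep P U V W <->
  forall C (mC : measurable C) (mVC := measurable_funPTI V mC),
    {ae P, forall x, cprob P ⟨U, W⟩ mVC (⟨U, W⟩ x) = cprob P W mVC (W x)}.
Proof.
split=> [UVW C mC mVC|h B C mB mC mUB mVC].
  apply/(cprob_factorP _ pair_rv_snd).
  set c := cprob P W mVC.
  have c0 x : (0 <= (c \o W) x)%R by exact: cprob_ge0.
  have ic : P.-integrable setT (EFin \o (c \o W)) by exact: integrable_cprob.
  (* The law of (U, W) weighted by P(V in C | W), to be compared on boxes with the law of (U, W) on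
     the event that V is in C. *)
  pose m1 := pushforward (mdensity c0 ic) ⟨U, W⟩.
  have box B D : measurable B -> measurable D ->
      m1 (B `*` D) = event_law (P := P) ⟨U, W⟩ mVC (B `*` D).
    move=> mB mD; rewrite /m1 /pushforward /mdensity /=.
    rewrite (integral_cprob_box mB mD).
    have mWD : measurable (W @^-1` D) by exact: measurable_funPTI.
    pose mUB := measurable_funPTI U mB.
    pose mI := measurableI _ _ mUB mVC.
    transitivity (\int[P]_(x in W @^-1` D) (cprob P W mI (W x))%:E).
      have mc E (mE : measurable E) : measurable_fun (W @^-1` D)
          (EFin \o (cprob P W mE \o W)).
        apply: measurable_funTS; apply/measurable_EFinP.
        by apply: measurableT_comp => //; exact: measurable_cprob.
      apply: ge0_ae_eq_integral => //.
      - under eq_fun do rewrite EFinM.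
        by apply: emeasurable_funM; exact: mc.
      - exact: mc.
      - by move=> x _; rewrite lee_fin mulr_ge0 ?cprob_ge0.
      - by move=> x _; rewrite lee_fin cprob_ge0.
      - have hI := ae_distribution (cond_prob_cprob W mI).
        have hU := ae_distribution (cond_prob_cprob W mUB).
        have hV := ae_distribution (cond_prob_cprob W mVC).
        have hUV := ae_distribution (UVW B C mB mC).
        apply: filterS2 (filterI hI hU) (filterI hV hUV).
        move=> x [+ +] [+ +] _ => -> -> ->.
        by rewrite -EFinM => -[->].
    rewrite integral_cprob// /event_law /mrestr; congr (P _).
    by apply/seteqP; split=> x /= => [[? []]|[[]]].
  move=> S mS.
  apply: (finite_measure_prod_unique (m1 := m1)
    (m2 := event_law (P := P) ⟨U, W⟩ mVC)) => //.
  exact: (fin_num_fun_lty (@fin_num_measure _ _ _ (mdensity c0 ic))).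
have mUVC := measurableI _ _ mUB mVC.
have mcU := measurable_cprob W mUB; have mcV := measurable_cprob W mVC.
(* Conversely, the product has the integrals that characterize the conditional probability of the
   intersection. *)
have key : {ae distribution P W, forall w,
    (cprob P W mUB w * cprob P W mVC w)%R = cprob P W mUVC w}.
  apply: cprob_unique => [|w|D mD].
  - exact: measurable_funM.
  - by rewrite mulr_ge0// cprob_ge0.
  - rewrite -integral_cprob_box//.
    rewrite (cprob_factorP _ pair_rv_snd).1//; last exact: measurableX.
      congr (P _).
      by apply/seteqP; split=> x /= => [[[]]|[? []]].
    exact: h.
have hI := cond_prob_cprob W mUVC.
have hU := cond_prob_cprob W mUB.
have hV := cond_prob_cprob W mVC.
apply: filterS2 (filterI hI hU) (filterI hV key) => w [+ +] [+ +].
rewrite (@cond_prob_irr _ _ _ _ _ _ _ _ _ (measurableI _ _ mUB mVC) mUVC)//.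
by move=> -> -> -> <-.
Qed.

End conditional_independence_characterization.

(** Every event of (U', W) is an event of (U, W), so the integral characterization of independence
    is inherited. *)
Lemma cond_indep_comp d dU dU' dV dW (T : measurableType d)
    (TU : measurableType dU) (TU' : measurableType dU')
    (TV : measurableType dV) (TW : measurableType dW) (R : realType)
    (P : probability T R) (U : {RV P >-> TU}) (U' : {RV P >-> TU'})
    (V : {RV P >-> TV}) (W : {RV P >-> TW}) (k : TU * TW -> TU') :
    measurable_fun setT k -> (forall x, U' x = k (U x, W x)) ->
  cond_indep P U V W -> cond_indep P U' V W.
Proof.
move=> mk U'E /cond_indepP h; apply/cond_indepP => C mC mVC.
apply/(cprob_factorP _ (pair_rv_snd _ _)) => S mS.
pose psi z := (k z, z.2) : TU' * TW.
have mpsi : measurable_fun setT psi by exact: measurable_fun_pair.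
have -> : ⟨U', W⟩ @^-1` S = ⟨U, W⟩ @^-1` (psi @^-1` S).
  by apply/seteqP; split=> x /=; rewrite /pair_rv /psi U'E.
apply: (cprob_factorP mVC (pair_rv_snd U W)).1; first exact: h.
by rewrite -[X in measurable X]setTI; exact: mpsi.
Qed.

(** * Conditional entropy *)

(** For q > 0 and y = ln (p / q) the expression is q (exp y - 1 - y), which is positive unless y =
    0; for q = 0 it is p. *)
Lemma gibbs_gap_ge0 (R : realType) (p q : R) : (0 < p -> 0 <= q ->
  0 <= - (q * ln p) + p - q + q * ln q /\
  (- (q * ln p) + p - q + q * ln q = 0 -> q = p))%R.
Proof.
move=> p0; rewrite le_eqVlt => /predU1P[<-|q0].
  by rewrite !mul0r; split; [lra|move=> ?; lra].
have [<-|pq] := eqVneq q p; first by split; [lra|].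
have t0 : (0 < p / q)%R by rewrite divr_gt0.
have y0 : ln (p / q) != 0%R.
  rewrite ln_eq0//; apply: contra pq => /eqP pq1.
  by rewrite -[p](divfK (lt0r_neq0 q0)) pq1 mul1r.
have := expR_gt1Dx y0; rewrite lnK ?posrE// ln_div ?posrE//.
rewrite -(ltr_pM2l q0) mulrCA divff ?lt0r_neq0// mulr1 => h.
suff : (0 < - (q * ln p) + p - q + q * ln q)%R by split; lra.
by move: h; nra.
Qed.

(** Finiteness of [e] allows the cancellation, and finiteness of [b] forces [G] to be real. *)
Lemma addeIr_gap (R : realType) (a b e G : \bar R) :
    a \is a fin_num -> b \is a fin_num -> e \is a fin_num -> 0 <= G ->
    a + G + e = b + e ->
  exists2 g : R, (0 <= g)%R & G = g%:E /\ b = a + g%:E.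
Proof.
case: a b e G => [a| |] [b| |] [e| |] [g| |] // _ _ _; rewrite lee_fin.
by move=> g0 [] /addIr <-; exists g.
Qed.

Lemma ge0_integral_eq0_ae d (T : measurableType d) (R : realType)
    (mu : {measure set T -> \bar R}) (D : set T) (f : T -> \bar R) :
    measurable D -> measurable_fun D f -> (forall x, D x -> 0 <= f x) ->
  \int[mu]_(x in D) f x = 0 -> {ae mu, forall x, D x -> f x = 0}.
Proof.
move=> mD mf f0 intf0; apply/(ae_eq_integral_abs mu mD mf); rewrite -intf0.
by apply: eq_integral => x /[!inE] Dx; rewrite gee0_abs// f0.
Qed.

(** The contribution of one event to a conditional entropy, in nats; the factor 0 gives 0 ln 0 the
    value 0. *)
Definition cond_entropy_term d d' (T : measurableType d)
    (T' : measurableType d') (R : realType) (P : probability T R)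
    (W : {RV P >-> T'}) (E : set T) (mE : measurable E) : \bar R :=
  \int[P]_x (- (cprob P W mE (W x) * ln (cprob P W mE (W x))))%:E.
Arguments cond_entropy_term {d d' T T' R} P W {E} mE.

Section conditional_entropy_of_an_event.
Context d d' (T : measurableType d) (T' : measurableType d') (R : realType).
Variables (P : probability T R) (W : {RV P >-> T'}).
Variables (E : set T) (mE : measurable E).

Let c := cprob P W mE.

Lemma measurable_cprob_RV : measurable_fun setT (c \o W).
Proof. by apply: measurableT_comp => //; exact: measurable_cprob. Qed.

Lemma ln_cprob_le0 w : (ln (c w) <= 0)%R.
Proof. by rewrite ln_le0// cprob_le1. Qed.

Lemma integral_ln_cprob :
  \int[P]_(x in E) (- ln (c (W x)))%:E = cond_entropy_term P W mE.
Proof.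
rewrite (ge0_integral_cprob W mE (g := fun w => (- ln (c w))%:E)).
- by apply: eq_integral => x _; rewrite -EFinM mulNr mulrC.
- apply/measurable_EFinP; apply: measurable_funN.
  by apply: measurableT_comp => //; exact: measurable_cprob.
- by move=> w; rewrite lee_fin oppr_ge0 ln_cprob_le0.
Qed.

Lemma cond_entropy_term_ge0 : 0 <= cond_entropy_term P W mE.
Proof.
apply: integral_ge0 => x _.
by rewrite lee_fin -mulrN mulr_ge0 ?cprob_ge0// oppr_ge0 ln_cprob_le0.
Qed.

Lemma cond_entropy_term_fin_num : cond_entropy_term P W mE \is a fin_num.
Proof.
rewrite ge0_fin_numE ?cond_entropy_term_ge0//.
apply: (@le_lt_trans _ _ (\int[P]_x (cst 1 x))); last first.
  by rewrite integral_cst// mul1e fin_num_fun_lty.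
have mc := measurable_cprob_RV.
apply: ge0_le_integral => //.
- move=> x _.
  by rewrite lee_fin -mulrN mulr_ge0 ?cprob_ge0// oppr_ge0 ln_cprob_le0.
- apply/measurable_EFinP; apply: measurable_funN; apply: measurable_funM => //.
  exact: measurableT_comp mc.
move=> x _; rewrite /cst lee_fin -/c; have := cprob_ge0 W mE (W x).
rewrite -/c le_eqVlt => /predU1P[<-|c0]; first by rewrite mul0r oppr0.
(* Gibbs' inequality with p = 1 reads - c ln c <= 1 - c, which gives the bound 1. *)
have [+ _] := gibbs_gap_ge0 ltr01 (ltW c0).
by rewrite ln1 mulr0; lra.
Qed.

Lemma integral_indic_cprob_eq0 :
  \int[P]_(x in E) (EFin \o \1_[set w | c w = 0%R]) (W x) = 0.
Proof.
have mc : measurable_fun setT c by exact: measurable_cprob.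
set Z := [set w | _].
have mZ : measurable Z.
  rewrite -[Z]setTI; apply: (mc measurableT [set 0%R]).
  exact: measurable_set1.
rewrite (ge0_integral_cprob W mE)//; last 2 first.
- exact/measurable_EFinP.
- by move=> w; rewrite lee_fin.
apply: integral0_eq => x _ /=; rewrite indicE.
case: (boolP (W x \in Z)) => [/[!inE] Zx|_]; last by rewrite mul0e.
by rewrite [cprob _ _ _ _]Zx mule0.
Qed.

(** The event where [E] occurs although its conditional probability is 0 has probability equal to
    the integral of that conditional probability over its zero set, hence 0. *)
Lemma cprob_gt0 : {ae P, forall x, E x -> (0 < c (W x))%R}.
Proof.
have mc : measurable_fun setT c by exact: measurable_cprob.
have mZ : measurable [set w | c w = 0%R].
  by rewrite -[X in measurable X]setTI; apply: (mc measurableT [set 0%R]);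
    exact: measurable_set1.
have := integral_indic_cprob_eq0; move/(ge0_integral_eq0_ae mE) => h.
have {}h : {ae P, forall x, E x ->
      (EFin \o (\1_[set w | c w = 0%R] : T' -> R)) (W x) = 0}.
  apply: h => [|x _]; last by rewrite lee_fin.
  apply: measurable_funTS; apply: measurableT_comp => //.
  exact/measurable_EFinP.
apply: filterS h => x h /h /= [] /eqP; rewrite indicE pnatr_eq0 eqb0 => Zx.
by rewrite lt0r cprob_ge0 andbT; apply: contra Zx => /eqP cx; rewrite inE.
Qed.

End conditional_entropy_of_an_event.

Section conditional_entropy_decreases.
Context d d' d'' (T : measurableType d) (T' : measurableType d')
  (T'' : measurableType d'') (R : realType).
Variables (P : probability T R) (W : {RV P >-> T'}) (W' : {RV P >-> T''}).
Hypothesis phi : exists2 f : T'' -> T', measurable_fun setT f &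
  forall x, W x = f (W' x).
Variables (E : set T) (mE : measurable E).

Let p x := cprob P W mE (W x).
Let q x := cprob P W' mE (W' x).

Let mp : measurable_fun setT p. Proof. exact: measurable_cprob_RV. Qed.
Let mq : measurable_fun setT q. Proof. exact: measurable_cprob_RV. Qed.
Let p0 x : (0 <= p x)%R. Proof. exact: cprob_ge0. Qed.
Let q0 x : (0 <= q x)%R. Proof. exact: cprob_ge0. Qed.

(** The event p = 0 is an event of [W'] on which [E] is null, so the integral of q over it
    vanishes. *)
Lemma cprob_eq0_factor : {ae P, forall x, p x = 0%R -> q x = 0%R}.
Proof.
have [f mf WE] := phi.
have mc := measurable_cprob W mE.
have mZ : measurable [set w | cprob P W mE w = 0%R].
  by rewrite -[X in measurable X]setTI; apply: (mc measurableT [set 0%R]);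
    exact: measurable_set1.
have mZf : measurable_fun setT
    (fun w' => (EFin \o (\1_[set w | cprob P W mE w = 0%R] : T' -> R)) (f w')).
  by apply: measurableT_comp => //; exact/measurable_EFinP.
have := integral_indic_cprob_eq0 W mE.
under eq_integral do rewrite WE.
rewrite (ge0_integral_cprob W' mE mZf); last by move=> w; rewrite lee_fin.
move/(ge0_integral_eq0_ae measurableT) => h.
have {}h : {ae P, forall x, setT x ->
   (EFin \o (\1_[set w | cprob P W mE w = 0%R] : T' -> R)) (f (W' x)) *
   (q x)%:E = 0}.
  apply: h => [|x _]; last by rewrite mule_ge0// lee_fin// q0.
  apply: emeasurable_funM; last exact/measurable_EFinP.
  exact: measurableT_comp mZf _.
apply: filterS h => x /(_ I); rewrite -WE /= indicE => + px.
by rewrite mem_set//= mul1e => -[].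
Qed.

(* Its mean is that of q ln (q / p), since p and q have the same mean. *)
Let gap x := (- (q x * ln (p x)) + p x - q x + q x * ln (q x))%R.

Let mgap : measurable_fun setT gap.
Proof.
apply: measurable_funD; last first.
  by apply: measurable_funM => //; exact: measurableT_comp mq.
apply: measurable_funB => //; apply: measurable_funD => //.
apply: measurable_funN; apply: measurable_funM => //.
exact: measurableT_comp mp.
Qed.

(** The real [g] is the mean of [gap], which is nonnegative by Gibbs' inequality; if the mean is 0,
    then [gap] vanishes almost surely and the equality case gives q = p. *)
Lemma cond_entropy_term_gap : exists2 g : R, (0 <= g)%R &
  cond_entropy_term P W mE = cond_entropy_term P W' mE + g%:E /\
  (g = 0%R -> {ae P, forall x, q x = p x}).
Proof.
have gap0 : {ae P, forall x, (0 <= gap x)%R /\ (gap x = 0%R -> q x = p x)}.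
  apply: filterS cprob_eq0_factor => x pq.
  have := p0 x; rewrite le_eqVlt => /predU1P[/esym px|px].
    by rewrite /gap (pq px) px !mul0r; split => //; rewrite oppr0 !addr0 subr0.
  exact: gibbs_gap_ge0.
have [f mf WE] := phi.
pose D x := (- (q x * ln (p x)))%:E.
have mD : measurable_fun setT D.
  apply/measurable_EFinP; apply: measurable_funN; apply: measurable_funM => //.
  exact: measurableT_comp mp.
have D0 x : 0 <= D x.
  by rewrite lee_fin -mulrN mulr_ge0 ?cprob_ge0// oppr_ge0 ln_cprob_le0.
pose A x := (- (q x * ln (q x)))%:E.
have mA : measurable_fun setT A.
  apply/measurable_EFinP; apply: measurable_funN; apply: measurable_funM => //.
  exact: measurableT_comp mq.
have A0 x : 0 <= A x.
  by rewrite lee_fin -mulrN mulr_ge0 ?cprob_ge0// oppr_ge0 ln_cprob_le0.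
have mG : measurable_fun setT (fun x => `|gap x|%:E).
  by apply/measurable_EFinP; exact: measurableT_comp.
have mpE : measurable_fun setT (fun x => (p x)%:E) by exact/measurable_EFinP.
have mqE : measurable_fun setT (fun x => (q x)%:E) by exact/measurable_EFinP.
(* As ln p is a function of both [W] and [W'], weighting it by q or by p amounts to integrating it
   over [E]: the cross entropy equals the entropy given [W]. *)
have intD : \int[P]_x D x = cond_entropy_term P W mE.
  rewrite -integral_ln_cprob.
  under [RHS]eq_integral do rewrite WE.
  rewrite (ge0_integral_cprob W' mE
    (g := fun w => (- ln (cprob P W mE (f w)))%:E)).
  - by apply: eq_integral => x _; rewrite -WE -EFinM mulNr mulrC.
  - apply/measurable_EFinP; apply: measurable_funN.
    apply: measurableT_comp => //; apply: measurableT_comp mf.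
    exact: measurable_cprob.
  - by move=> w; rewrite lee_fin oppr_ge0 ln_cprob_le0.
have intp : \int[P]_x (p x)%:E = P E.
  by have := integral_cprob W mE measurableT; rewrite preimage_setT setTI.
have intq : \int[P]_x (q x)%:E = P E.
  by have := integral_cprob W' mE measurableT; rewrite preimage_setT setTI.
(* All summands are kept nonnegative so that the integrals split in the extended reals; [gap] is
   nonnegative only almost surely, whence the absolute value. *)
have : \int[P]_x (A x + `|gap x|%:E + (q x)%:E) = \int[P]_x (D x + (p x)%:E).
  apply: ge0_ae_eq_integral => //.
  - by apply: emeasurable_funD => //; exact: emeasurable_funD.
  - exact: emeasurable_funD.
  - by move=> x _; rewrite !adde_ge0// lee_fin.
  - by move=> x _; rewrite !adde_ge0// lee_fin.
  - apply: filterS gap0 => x [g0 _] _; rewrite ger0_norm//.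
    by rewrite /A /D /gap -!EFinD; congr (_%:E); ring.
rewrite ge0_integralD//; last 3 first.
- by move=> x _; rewrite adde_ge0// lee_fin.
- exact: emeasurable_funD.
- by move=> x _; rewrite lee_fin.
rewrite ge0_integralD// ge0_integralD//; last by move=> x _; rewrite lee_fin.
rewrite intD intp intq => sumE.
have [||||g g0 [gE ->]] := addeIr_gap _ _ _ _ sumE.
- exact: cond_entropy_term_fin_num.
- exact: cond_entropy_term_fin_num.
- exact: fin_num_measure.
- by apply: integral_ge0 => x _; rewrite lee_fin.
exists g => //; split => // g00.
have h : {ae P, forall x, setT x -> `|gap x|%:E = 0}.
  by apply: ge0_integral_eq0_ae => //; rewrite gE g00.
apply: filterS2 gap0 h => x [_ +] /(_ I) [] /eqP.
by rewrite normr_eq0 => + /eqP; exact.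
Qed.

Lemma cond_entropy_term_le :
  cond_entropy_term P W' mE <= cond_entropy_term P W mE.
Proof. by have [g g0 [-> _]] := cond_entropy_term_gap; rewrite leeDl. Qed.

Lemma cond_entropy_term_eqP :
  cond_entropy_term P W' mE = cond_entropy_term P W mE <->
  {ae P, forall x, q x = p x}.
Proof.
split=> [|h].
  have [g g0 [-> gE]] := cond_entropy_term_gap.
  have := cond_entropy_term_fin_num W' mE.
  case: (cond_entropy_term P W' mE) => // a _ [] /eqP.
  by rewrite -subr_eq0 opprD addNKr oppr_eq0 => /eqP.
apply: ge0_ae_eq_integral => //.
- apply/measurable_EFinP; apply: measurable_funN; apply: measurable_funM => //.
  exact: measurableT_comp mq.
- apply/measurable_EFinP; apply: measurable_funN; apply: measurable_funM => //.
  exact: measurableT_comp mp.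
- move=> x _.
  by rewrite lee_fin -mulrN mulr_ge0 ?cprob_ge0// oppr_ge0 ln_cprob_le0.
- move=> x _.
  by rewrite lee_fin -mulrN mulr_ge0 ?cprob_ge0// oppr_ge0 ln_cprob_le0.
- by apply: filterS h => x + _; rewrite /q /p => ->.
Qed.

End conditional_entropy_decreases.

(** * Conditional mutual information *)

Lemma measurable_lne_EFin (R : realType) :
  measurable_fun setT (fun r : R => lne r%:E).
Proof.
apply: (measurable_fun_ifT (f := fun r : R => (r <= 0)%R)) => //.
- exact: measurable_fun_ler.
- by apply/measurable_EFinP; exact: measurable_ln.
Qed.

(** The density [f] agrees with the Radon-Nikodym derivative [nu]-almost everywhere, hence
    [mu]-almost everywhere by domination. *)
Lemma kl_div_density d (T : measurableType d) (R : realType)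
    (mu nu : probability T R) (f : T -> R) :
    measurable_fun setT f -> (forall x, 0 <= f x)%R ->
    (forall S, measurable S -> mu S = \int[nu]_(x in S) (f x)%:E) ->
  kl_div mu nu = \int[mu]_x lne (f x)%:E.
Proof.
move=> mf f0 muE.
have mfE : measurable_fun setT (EFin \o f) by exact/measurable_EFinP.
have dom : mu `<< nu.
  apply/null_content_dominatesP => S mS nuS0; rewrite muE//.
  transitivity (\int[nu]_(x in S) `|(f x)%:E|).
    by apply: eq_integral => x _; rewrite gee0_abs// lee_fin.
  by apply: integral_abs_eq0 => //; exact: measurable_funTS.
rewrite /kl_div asboolT//.
have h : ae_eq nu setT ('d (charge_of_finite_measure mu) '/d nu) (EFin \o f).
  apply: integral_ae_eq => //; first exact: Radon_Nikodym_integrable.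
  by move=> S _ mS; rewrite -Radon_Nikodym_integral//= -muE.
have {}h := null_dominates_ae_eq measurableT dom h.
apply: ae_eq_integral => //.
- have mD : measurable_fun setT ('d (charge_of_finite_measure mu) '/d nu).
    by apply: measurable_int; exact: Radon_Nikodym_integrable.
  (* The derivative is finite-valued, so passing through [fine] reduces to measurability of the
     logarithm on the reals. *)
  rewrite [X in measurable_fun _ X](_ : _ = (fun r => lne r%:E) \o
      (fine \o ('d (charge_of_finite_measure mu) '/d nu))).
    apply: measurableT_comp; first exact: measurable_lne_EFin.
    by apply: measurableT_comp => //; exact: fine_measurable.
  by apply/funext => x; rewrite /comp fineK// Radon_Nikodym_fin_num.
- exact: (measurableT_comp (@measurable_lne_EFin R) mf).
- by apply: filterS h => x + _ => /(_ I) ->.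
Qed.

Section cond_prod_law_uniqueness.
Context d dU dV dW (T : measurableType d) (TU : measurableType dU)
  (TV : measurableType dV) (TW : measurableType dW) (R : realType).
Variables (P : probability T R).
Variables (U : {RV P >-> TU}) (V : {RV P >-> TV}) (W : {RV P >-> TW}).

Lemma cond_prod_law_unique (Q1 Q2 : probability (TU * TV * TW)%type R) :
    is_cond_prod_law P U V W Q1 -> is_cond_prod_law P U V W Q2 ->
  forall S, measurable S -> Q1 S = Q2 S.
Proof.
move=> h1 h2; apply: finite_measure_prod3_unique => [|B C D mB mC mD].
  exact: fin_num_fun_lty.
exact: etrans (h1 B C D mB mC mD) (esym (h2 B C D mB mC mD)).
Qed.

(** The law chosen by [get] meets its specification as soon as some law does, and uniqueness then
    identifies the two. *)
Lemma cond_prod_lawP (Q : probability (TU * TV * TW)%type R) :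
    is_cond_prod_law P U V W Q ->
  forall S, measurable S -> cond_prod_law P U V W S = Q S.
Proof.
move=> h; apply: cond_prod_law_unique => //.
by apply: getPex; exists Q.
Qed.

Definition swap12 (z : TU * TV * TW) : TV * TU * TW := (z.1.2, z.1.1, z.2).

Lemma measurable_swap12 : measurable_fun setT swap12.
Proof.
apply: measurable_fun_pair => //; apply: measurable_fun_pair.
  by apply: measurableT_comp => //; exact: measurable_snd.
by apply: measurableT_comp => //; exact: measurable_fst.
Qed.

HB.instance Definition _ :=
  isMeasurableFun.Build _ _ _ _ swap12 measurable_swap12.

Lemma cond_prod_law_swap (Q : probability (TU * TV * TW)%type R) :
    is_cond_prod_law P U V W Q ->
  is_cond_prod_law P V U W (distribution Q swap12).
Proof.
move=> h C B D mC mB mD.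
transitivity (Q (B `*` C `*` D)).
  rewrite /= /distribution /pushforward; congr (Q _).
  by apply/seteqP; split=> -[[u v] w] /= => -[[]].
by rewrite h//; apply: eq_integral => w _; rewrite muleC.
Qed.

End cond_prod_law_uniqueness.

Section measure_image.
Context d1 d2 (T1 : measurableType d1) (T2 : measurableType d2) (R : realType).
Variables (m : {measure set T1 -> \bar R}) (f : {mfun T1 >-> T2}).

Definition mimage : set T2 -> \bar R := pushforward m f.

Let mimage0 : mimage set0 = 0. Proof. exact: measure0. Qed.

Let mimage_ge0 A : 0 <= mimage A. Proof. exact: measure_ge0. Qed.

Let mimage_sigma_additive : semi_sigma_additive mimage.
Proof. exact: measure_semi_sigma_additive. Qed.

HB.instance Definition _ := isMeasure.Build _ _ _ mimage
  mimage0 mimage_ge0 mimage_sigma_additive.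

End measure_image.

(** * Conditional entropy of a finite-valued variable *)

Section discrete_random_variable.
Context d dV (T : measurableType d) (TV : measurableType dV) (R : realType).
Variables (P : probability T R) (V : {RV P >-> TV}).
Variable s : seq TV.
Hypotheses (s_uniq : uniq s) (s_full : forall v, v \in s).
Hypothesis m1 : forall v : TV, measurable [set v].

Let mv v := measurable_funPTI V (m1 v).

Lemma sum_indic1 (g : TV -> R) (a : TV) :
  (\sum_(v <- s) \1_[set v] a * g v = g a)%R.
Proof.
rewrite (bigD1_seq a)//= indicE mem_set// mul1r big1 ?addr0// => v va.
by rewrite indicE memNset ?mul0r// => /= /esym /eqP; exact/negP.
Qed.

Lemma total_probability (F : set T) : measurable F ->
  \sum_(v <- s) P (F `&` V @^-1` [set v]) = P F.
Proof.
move=> mF; rewrite -[RHS]mul1e -integral_cst//.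
transitivity (\int[P]_(x in F) \sum_(v <- s) (\1_(V @^-1` [set v]) x)%:E).
  rewrite ge0_integral_sum//.
  - by apply: eq_bigr => v _; rewrite integral_indic// setIC.
  - by move=> v; apply: measurable_funTS; exact/measurable_EFinP.
apply: eq_integral => x _; rewrite sumEFin; congr (_%:E).
rewrite -[RHS](sum_indic1 (fun=> 1%R) (V x)).
by apply: eq_bigr => v _; rewrite mulr1 !indicE.
Qed.

Section given.
Context dW (TW : measurableType dW).
Variable W : {RV P >-> TW}.

(** By total probability, the sum has the integrals that characterize P(V in C | W). *)
Lemma cprob_sum (C : set TV) (mC : measurable C) :
  {ae distribution P W, forall w,
    (\sum_(v <- s) \1_C v * cprob P W (mv v) w)%R =
    cprob P W (measurable_funPTI V mC) w}.
Proof.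
have mcv v : measurable_fun setT (fun w => \1_C v * cprob P W (mv v) w)%R.
  by apply: measurable_funM => //; exact: measurable_cprob.
apply: cprob_unique => [|w|B mB].
- exact: measurable_sum.
- by apply: sumr_ge0 => v _; rewrite mulr_ge0 ?cprob_ge0.
have mWB : measurable (W @^-1` B) by exact: measurable_funPTI.
have mF : measurable (W @^-1` B `&` V @^-1` C).
  by apply: measurableI => //; exact: measurable_funPTI.
rewrite -(total_probability mF).
under eq_integral do rewrite -sumEFin.
rewrite ge0_integral_sum//; last 2 first.
- move=> v; apply: measurable_funTS; apply/measurable_EFinP.
  exact: (measurableT_comp (mcv v) (measurable_funPT W)).
- by move=> v x _; rewrite lee_fin mulr_ge0 ?cprob_ge0.
apply: eq_bigr => v _; rewrite indicE.
have [/set_mem Cv|/negP nCv] := boolP (v \in C).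
  under eq_integral do rewrite mul1r.
  rewrite integral_cprob//; congr (P _).
  by apply/seteqP; split=> x /= => [[? ->]|[[? _] ->]].
under eq_integral do rewrite mul0r.
rewrite integral0 [X in P X](_ : _ = set0) ?measure0//.
by apply/seteqP; split=> x //= [[_ CV] Vv]; apply: nCv; rewrite inE -Vv.
Qed.

Definition cond_entropy : \bar R :=
  \sum_(v <- s) cond_entropy_term P W (mv v).

Lemma cond_entropy_fin_num : cond_entropy \is a fin_num.
Proof.
by apply/sum_fin_numP => v _ _; exact: cond_entropy_term_fin_num.
Qed.

(** Written as a finite sum over the values of [V] so that measurability and integration proceed
    term by term; the sum collapses to the single term at [V x]. *)
Definition surprisal (x : T) : R :=
  (\sum_(v <- s) \1_[set v] (V x) * - ln (cprob P W (mv v) (W x)))%R.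

Lemma surprisalE x :
  surprisal x = (- ln (cprob P W (mv (V x)) (W x)))%R.
Proof. exact: (sum_indic1 (fun v => - ln (cprob P W (mv v) (W x)))%R). Qed.

Let msurp v : measurable_fun setT
  (fun x => \1_[set v] (V x) * - ln (cprob P W (mv v) (W x)))%R.
Proof.
apply: measurable_funM.
  by apply: measurableT_comp => //; exact: measurable_indic.
apply: measurable_funN; apply: measurableT_comp => //.
exact: measurable_cprob_RV.
Qed.

Lemma integral_surprisal : \int[P]_x (surprisal x)%:E = cond_entropy.
Proof.
under eq_integral do rewrite /surprisal -sumEFin.
rewrite ge0_integral_sum//; last 2 first.
- by move=> v; exact/measurable_EFinP.
- by move=> v x _; rewrite lee_fin mulr_ge0// oppr_ge0 ln_cprob_le0.
apply: eq_bigr => v _; rewrite -integral_ln_cprob [RHS]integral_mkcond.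
apply: eq_integral => x _; rewrite epatch_indic/= -EFinM mulrC.
by rewrite !indicE.
Qed.

Lemma integrable_surprisal : P.-integrable setT (EFin \o surprisal).
Proof.
apply/integrableP; split.
  by apply/measurable_EFinP; exact: measurable_sum.
under eq_integral do
  rewrite /= ger0_norm ?surprisalE ?oppr_ge0 ?ln_cprob_le0// -surprisalE.
by rewrite integral_surprisal ltey_eq cond_entropy_fin_num.
Qed.

End given.
End discrete_random_variable.

Lemma mnormalize1E d (T : measurableType d) (R : realType)
    (mu : {measure set T -> \bar R}) (P : probability T R) (S : set T) :
  mu setT = 1 -> mnormalize mu P S = mu S.
Proof.
move=> muT.
by rewrite /mnormalize muT/= onee_eq0/= invr1 mule1.
Qed.

(** * The conditional product law as a mixture, and the density of the joint law *)

Section conditional_mutual_information.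
Context d dU dV dW (T : measurableType d) (TU : measurableType dU)
  (TV : measurableType dV) (TW : measurableType dW) (R : realType).
Variables (P : probability T R).
Variables (U : {RV P >-> TU}) (V : {RV P >-> TV}) (W : {RV P >-> TW}).
Variable s : seq TV.
Hypotheses (s_uniq : uniq s) (s_full : forall v, v \in s).
Hypothesis m1 : forall v : TV, measurable [set v].

Let mv v := measurable_funPTI V (m1 v).
Let p v := cprob P W (mv v).
Let q v := cprob P ⟨U, W⟩ (mv v).

Let Z : {mfun T >-> (TU * TV * TW)%type} := ⟨⟨U, V⟩, W⟩.
Let slice v : {mfun T >-> (TU * TV * TW)%type} := ⟨⟨U, cst v⟩, W⟩.

Let pW0 v x : (0 <= (p v \o W) x)%R. Proof. exact: cprob_ge0. Qed.
Let ipW v : P.-integrable setT (EFin \o (p v \o W)).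
Proof. exact: integrable_cprob. Qed.

(** The image under (U, v, W) of [P] weighted by P(V = v | W). Components are indexed by their
    position in [s], as [msum] sums over natural numbers. *)
Let m (i : nat) : {measure set (TU * TV * TW)%type -> \bar R} :=
  mimage (mdensity (pW0 (nth point s i)) (ipW (nth point s i)))
    (slice (nth point s i)).

Let mixture := msum m (size s).

Let mixtureE S :
  mixture S = \sum_(v <- s) \int[P]_(x in slice v @^-1` S) (p v (W x))%:E.
Proof. by rewrite (big_nth point) big_mkord. Qed.

Let integral_mixture (g : TU * TV * TW -> \bar R) :
    measurable_fun setT g -> (forall z, 0 <= g z) ->
  \int[mixture]_z g z =
  \sum_(v <- s) \int[P]_x (g (U x, v, W x) * (p v (W x))%:E).
Proof.
move=> mg g0; rewrite ge0_integral_measure_sum// (big_nth point) big_mkord.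
apply: eq_bigr => i _; set v := nth point s i.
transitivity (\int[mdensity (pW0 v) (ipW v)]_x (g \o slice v) x).
  by rewrite [LHS]ge0_integral_pushforward.
rewrite ge0_integral_mdensity//; first exact: measurableT_comp.
by move=> x; exact: g0.
Qed.

(** The component of v sees the box as the event that (U, W) lies in B times D if v is in C, and as
    the empty event otherwise; [integral_cprob_box] evaluates it, and [cprob_sum] adds up the values
    in C. *)
Let mixture_box (B : set TU) (C : set TV) (D : set TW) (mB : measurable B)
    (mC : measurable C) : measurable D ->
  mixture (B `*` C `*` D) = \int[distribution P W]_(w in D)
    (cond_prob P W (measurable_funPTI U mB) w *
     cond_prob P W (measurable_funPTI V mC) w).
Proof.
move=> mD; rewrite mixtureE.
set cB := cprob P W (measurable_funPTI U mB).
have mcB : measurable_fun setT cB by exact: measurable_cprob.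
have mp v : measurable_fun setT (p v) by exact: measurable_cprob.
have mT v : measurable_fun setT (fun w => (cB w * (\1_C v * p v w))%:E).
  apply/measurable_EFinP; apply: measurable_funM => //.
  exact: measurable_funM.
transitivity (\sum_(v <- s)
    \int[distribution P W]_(w in D) (cB w * (\1_C v * p v w))%:E).
  apply: eq_bigr => v _.
  rewrite ge0_integral_pushforward//; last 2 first.
  - exact: measurable_funTS.
  - by move=> w _; rewrite lee_fin !mulr_ge0 ?cprob_ge0.
  rewrite indicE; have [/set_mem Cv|/negP nCv] := boolP (v \in C).
    have -> : slice v @^-1` (B `*` C `*` D) = ⟨U, W⟩ @^-1` (B `*` D).
      by apply/seteqP; split=> x /= [] // [].
    rewrite (integral_cprob_box U W mB mD (mv v)).
    by apply: eq_integral => x _ /=; rewrite mul1r.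
  under [RHS]eq_integral do rewrite /= mul0r mulr0.
  rewrite integral0 (_ : _ @^-1` _ = set0) ?integral_set0//.
  apply/seteqP; split=> x //= [[_ Cv] _]; apply: nCv.
  by rewrite inE.
rewrite -ge0_integral_sum//; last 2 first.
- by move=> v; exact: measurable_funTS.
- by move=> v w _; rewrite lee_fin !mulr_ge0 ?cprob_ge0.
apply: ae_eq_integral => //.
- by apply: measurable_funTS; apply: emeasurable_sum.
- by apply: measurable_funTS; apply: emeasurable_funM;
    exact: measurable_cond_prob.
have hB := cond_prob_cprob W (measurable_funPTI U mB).
have hC := cond_prob_cprob W (measurable_funPTI V mC).
apply: filterS3 hB hC (cprob_sum V s_uniq s_full m1 W mC).
move=> w -> -> <- _.
by rewrite -EFinM sumEFin mulr_sumr.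
Qed.

Let mixtureT : mixture setT = 1.
Proof.
rewrite mixtureE -(@probability_setT _ _ _ P).
rewrite -(total_probability V s_uniq s_full m1 measurableT).
by apply: eq_bigr => v _; rewrite -(integral_cprob W (mv v) measurableT).
Qed.

(** The mixture has mass 1, so normalization keeps its values while providing the structure of a
    probability. *)
Definition mixture_law : probability (TU * TV * TW)%type R :=
  mnormalize mixture (distribution P Z).

Lemma mixture_lawE S : mixture_law S = mixture S.
Proof. exact: mnormalize1E mixtureT. Qed.

Lemma mixture_law_cond_prod : is_cond_prod_law P U V W mixture_law.
Proof. by move=> B C D mB mC mD; rewrite mixture_lawE mixture_box. Qed.

(* exp(- ln p) is 1/p when p > 0; the value at p = 0 is irrelevant, since then
   q = 0 almost surely. *)
Definition cond_density (z : TU * TV * TW) : R :=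
  (\sum_(v <- s) \1_[set v] z.1.2 *
    (q v (z.1.1, z.2) * expR (- ln (p v z.2))))%R.

Lemma cond_densityE u v w :
  cond_density (u, v, w) = (q v (u, w) * expR (- ln (p v w)))%R.
Proof.
by rewrite /cond_density (sum_indic1 s_uniq s_full
  (fun v => (q v (u, w) * expR (- ln (p v w)))%R)).
Qed.

Lemma cond_density_ge0 z : (0 <= cond_density z)%R.
Proof.
by apply: sumr_ge0 => v _; rewrite !mulr_ge0 ?cprob_ge0 ?expR_ge0.
Qed.

Let m11 : measurable_fun setT (fun z : TU * TV * TW => z.1.1).
Proof. exact: measurableT_comp measurable_fst measurable_fst. Qed.

Let m12 : measurable_fun setT (fun z : TU * TV * TW => z.1.2).
Proof. exact: measurableT_comp measurable_snd measurable_fst. Qed.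

Lemma measurable_cond_density : measurable_fun setT cond_density.
Proof.
apply: measurable_sum => v; apply: measurable_funM.
  by apply: measurableT_comp m12; exact: measurable_indic.
apply: measurable_funM.
  apply: (measurableT_comp (measurable_cprob ⟨U, W⟩ (mv v))).
  exact: measurable_fun_pair m11 measurable_snd.
apply: measurableT_comp => //; apply: measurable_funN.
apply: measurableT_comp => //.
exact: (measurableT_comp (measurable_cprob W (mv v)) measurable_snd).
Qed.

(** In the component of v the weight p cancels the denominator of q / p. What remains is the
    integral of P(V = v | U, W), which gives the part of the joint law where V = v. *)
Lemma integral_cond_density S : measurable S ->
  distribution P Z S = \int[cond_prod_law P U V W]_(z in S) (cond_density z)%:E.
Proof.
move=> mS.
rewrite (eq_measure_integral mixture); last first.
  move=> A mA _; apply: etrans (mixture_lawE A).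
  exact: (cond_prod_lawP mixture_law_cond_prod).
have mf := measurable_cond_density.
have m1S : measurable_fun setT (\1_S : _ -> R) by exact: measurable_indic.
transitivity (\int[mixture]_z (cond_density z * \1_S z)%:E); last first.
  rewrite [RHS]integral_mkcond; apply: eq_integral => z _.
  by rewrite epatch_indic EFinM.
rewrite integral_mixture; last 2 first.
- by apply/measurable_EFinP; exact: measurable_funM.
- by move=> z; rewrite lee_fin mulr_ge0 ?cond_density_ge0.
have mZS : measurable (Z @^-1` S) by exact: measurable_funPTI.
rewrite /distribution /pushforward -(total_probability V s_uniq s_full m1 mZS).
apply: eq_bigr => v _.
(* On the event V = v, membership of (U, V, W) in [S] depends on (U, W) alone. *)
pose g (y : TU * TW) := (\1_S (y.1, v, y.2) : R)%:E.
have mslice : measurable_fun setT (fun y : TU * TW => (y.1, v, y.2)).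
  by apply: measurable_fun_pair => //; exact: measurable_fun_pair.
have mg : measurable_fun setT g.
  by apply/measurable_EFinP; exact: measurableT_comp m1S mslice.
have g0 y : 0 <= g y by rewrite lee_fin.
have mZv : measurable (Z @^-1` S `&` V @^-1` [set v]).
  by apply: measurableI => //; exact: mv.
transitivity (\int[P]_(x in V @^-1` [set v]) g (⟨U, W⟩ x)).
  rewrite -[LHS]mul1e -integral_cst// [LHS]integral_mkcondl.
  apply: eq_integral => x; rewrite inE /= => Vx.
  by rewrite epatch_indic mul1e /g /= -Vx !indicE.
rewrite (ge0_integral_cprob ⟨U, W⟩ (mv v) mg g0).
have mqW := measurable_cprob_RV ⟨U, W⟩ (mv v).
have mgW : measurable_fun setT (g \o ⟨U, W⟩) by exact: measurableT_comp.
have mUvW : measurable_fun setT (slice v) by exact: measurable_funPT.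
apply: ge0_ae_eq_integral => //.
- by apply: emeasurable_funM; [exact: mgW|exact/measurable_EFinP/mqW].
- apply: emeasurable_funM; apply/measurable_EFinP.
    apply: measurable_funM; first exact: measurableT_comp mf mUvW.
    exact: measurableT_comp m1S mUvW.
  exact: measurable_cprob_RV.
- by move=> x _; rewrite mule_ge0// lee_fin cprob_ge0.
- by move=> x _; rewrite -EFinM lee_fin !mulr_ge0 ?cprob_ge0 ?cond_density_ge0.
(* The cancellation of p is legitimate where p > 0; where p = 0, almost surely q = 0 and both sides
   vanish. *)
- apply: filterS (cprob_eq0_factor (pair_rv_snd U W) (mv v)) => x pq _.
  rewrite cond_densityE /g /= -!EFinM; congr (_%:E).
  have := cprob_ge0 W (mv v) (W x); rewrite -/(p v (W x)).
  rewrite le_eqVlt => /predU1P[/esym p0|p0].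
    have q0 : q v (U x, W x) = 0%R by exact: pq.
    by rewrite p0 -[cprob _ _ _ _]/(q v (U x, W x)) q0 !mulr0.
  rewrite expRN lnK ?posrE// -[cprob _ _ _ _]/(q v (U x, W x)).
  by field; rewrite gt_eqF.
Qed.

End conditional_mutual_information.

Lemma ae_integrable d (T : measurableType d) (R : realType)
    (mu : {measure set T -> \bar R}) (f g : T -> \bar R) :
    measurable_fun setT f -> mu.-integrable setT g ->
    {ae mu, forall x, f x = g x} ->
  mu.-integrable setT f.
Proof.
move=> mf /integrableP[mg goo] fg; apply/integrableP; split => //.
rewrite (ge0_ae_eq_integral (g := fun x => `|g x|))//.
- exact: measurableT_comp.
- exact: measurableT_comp.
- by apply: filterS fg => x ->.
Qed.

(** Integrability of [L] justifies moving the integral of the signed function ln f from the law of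
    [Z] to the underlying space. *)
Lemma kl_div_log_density d d' (T : measurableType d) (T' : measurableType d')
    (R : realType) (P : probability T R) (Z : {RV P >-> T'})
    (nu : probability T' R) (f : T' -> R) (L : T -> R) :
    measurable_fun setT f -> (forall z, 0 <= f z)%R ->
    (forall S, measurable S ->
      distribution P Z S = \int[nu]_(z in S) (f z)%:E) ->
    P.-integrable setT (EFin \o L) ->
    {ae P, forall x, lne (f (Z x))%:E = (L x)%:E} ->
  kl_div (distribution P Z) nu = \int[P]_x (L x)%:E.
Proof.
move=> mf f0 fE iL fL; rewrite (kl_div_density mf f0 fE).
have mlf : measurable_fun setT (fun z => lne (f z)%:E).
  exact: (measurableT_comp (@measurable_lne_EFin R) mf).
have mlfZ : measurable_fun setT ((fun z => lne (f z)%:E) \o Z).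
  exact: measurableT_comp.
rewrite integral_distribution//; last exact: ae_integrable iL fL.
apply: ae_eq_integral => //; first exact: measurable_int iL.
by apply: filterS fL => x + _.
Qed.

Lemma ae_seq d (T : measurableType d) (R : realType)
    (mu : {measure set T -> \bar R}) (I : eqType) (s : seq I)
    (Q : I -> T -> Prop) :
    (forall i, {ae mu, forall x, Q i x}) ->
  {ae mu, forall x, forall i, i \in s -> Q i x}.
Proof.
move=> Qi; elim: s => [|i s ih]; first exact: aeW.
apply: filterS2 (Qi i) ih => x Qix Qs j.
by rewrite inE => /predU1P[->//|]; exact: Qs.
Qed.

(** * Conditional mutual information as a difference of entropies *)

Section mutual_information_entropy.
Context d dU dV dW (T : measurableType d) (TU : measurableType dU)
  (TV : measurableType dV) (TW : measurableType dW) (R : realType).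
Variables (P : probability T R).
Variables (U : {RV P >-> TU}) (V : {RV P >-> TV}) (W : {RV P >-> TW}).
Variable s : seq TV.
Hypotheses (s_uniq : uniq s) (s_full : forall v, v \in s).
Hypothesis m1 : forall v : TV, measurable [set v].

Let H dX (TX : measurableType dX) (X : {RV P >-> TX}) :=
  cond_entropy V s m1 X.

(** The information density ln (P(V | U, W) / P(V | W)) at the realized values, split into two
    integrable surprisals. *)
Let L x : R := (surprisal V s m1 W x - surprisal V s m1 ⟨U, W⟩ x)%R.

Let iL : P.-integrable setT (EFin \o L).
Proof.
have -> : EFin \o L = (EFin \o surprisal V s m1 W) \-
    (EFin \o surprisal V s m1 ⟨U, W⟩) by apply/funext => x; rewrite /= EFinB.
by apply: integrableB => //; exact: integrable_surprisal.
Qed.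

Let intL : \int[P]_x (L x)%:E = H W - H ⟨U, W⟩.
Proof.
under eq_integral do rewrite EFinB.
rewrite integralB//; [|exact: integrable_surprisal..].
by rewrite !integral_surprisal.
Qed.

(** Almost surely the realized value of [V] has positive conditional probability given [W] and given
    (U, W), so the logarithm of the density splits. *)
Let lne_density : {ae P, forall x,
  lne (cond_density U V W s m1 (U x, V x, W x))%:E = (L x)%:E}.
Proof.
have hW := ae_seq s (fun v => cprob_gt0 W (measurable_funPTI V (m1 v))).
have hUW := ae_seq s
  (fun v => cprob_gt0 (P := P) ⟨U, W⟩ (measurable_funPTI V (m1 v))).
apply: filterS2 hW hUW => x /(_ (V x) (s_full _) erefl) p0.
move=> /(_ (V x) (s_full _) erefl) q0.
rewrite (cond_densityE U V W s_uniq s_full m1) /L !(surprisalE V s_uniq s_full).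
rewrite lne_EFin ?mulr_gt0 ?expR_gt0// lnM ?posrE ?expR_gt0// expRK.
by rewrite opprK addrC.
Qed.

Lemma cond_mutual_infoE : cond_mutual_info P U V W = H W - H ⟨U, W⟩.
Proof.
rewrite -intL; apply: (kl_div_log_density (f := cond_density U V W s m1)) => //.
- exact: measurable_cond_density.
- by move=> z; exact: cond_density_ge0.
- exact: integral_cond_density.
Qed.

(** The version with the finite-valued variable in the first slot: exchanging the first two
    coordinates carries the joint law, the product law and the density along. *)
Lemma cond_mutual_info_swapE : cond_mutual_info P V U W = H W - H ⟨U, W⟩.
Proof.
have mf := measurable_cond_density U V W s m1.
rewrite -intL; apply: (kl_div_log_density
  (f := cond_density U V W s m1 \o @swap12 _ _ _ TV TU TW)) => //.
- by apply: measurableT_comp => //; exact: measurable_swap12.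
- by move=> z; exact: cond_density_ge0.
move=> S mS; pose Q := cond_prod_law P U V W.
have QP : is_cond_prod_law P U V W Q.
  apply: getPex; exists (mixture_law U V W s m1).
  exact: mixture_law_cond_prod.
transitivity (distribution P ⟨⟨U, V⟩, W⟩ (@swap12 _ _ _ TU TV TW @^-1` S)).
  by [].
have mSS : measurable (@swap12 _ _ _ TU TV TW @^-1` S).
  exact: measurable_funPTI.
rewrite (integral_cond_density U V W s_uniq s_full m1 mSS).
rewrite (eq_measure_integral (distribution Q (@swap12 _ _ _ TU TV TW)));
  last first.
  by move=> A mA _; apply: (cond_prod_lawP (cond_prod_law_swap QP)).
rewrite ge0_integral_pushforward//.
- apply: measurable_funTS; apply/measurable_EFinP.
  by apply: measurableT_comp => //; exact: measurable_swap12.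
- by move=> z _; rewrite lee_fin cond_density_ge0.
Qed.

End mutual_information_entropy.

(** * Sufficient representations *)

Lemma fin_num_subeI (R : realType) (a b c : \bar R) :
    a \is a fin_num -> b \is a fin_num -> c \is a fin_num ->
  a - b = a - c -> b = c.
Proof.
by case: a b c => [a| |] [b| |] [c| |] // _ _ _ [] /addrI /oppr_inj ->.
Qed.

Lemma fin_num_sube_gap (R : realType) (a b c : \bar R) :
    a \is a fin_num -> b \is a fin_num -> c \is a fin_num -> b <= c ->
  a - c <= a - b /\ (a - b = a - c <-> c - b = 0).
Proof.
case: a b c => [a| |] [b| |] [c| |] // _ _ _; rewrite lee_fin => bc.
rewrite -!EFinB lee_fin lerD2l lerN2; split => //.
split=> [[] /addrI /oppr_inj ->|[] /eqP]; first by rewrite subrr.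
by rewrite subr_eq0 => /eqP ->.
Qed.

Section discrete_conditional_entropy.
Context d dV (T : measurableType d) (TV : measurableType dV) (R : realType).
Variables (P : probability T R) (V : {RV P >-> TV}).
Variable s : seq TV.
Hypotheses (s_uniq : uniq s) (s_full : forall v, v \in s).
Hypothesis m1 : forall v : TV, measurable [set v].

Let mv v := measurable_funPTI V (m1 v).
Let H dX (TX : measurableType dX) (X : {RV P >-> TX}) :=
  cond_entropy V s m1 X.

Section factor.
Context dW dW' (TW : measurableType dW) (TW' : measurableType dW').
Variables (W : {RV P >-> TW}) (W' : {RV P >-> TW'}).
Hypothesis phi : exists2 f : TW' -> TW, measurable_fun setT f &
  forall x, W x = f (W' x).

Lemma cond_entropy_le : H W' <= H W.
Proof. by apply: lee_sum => v _; exact: cond_entropy_term_le. Qed.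

(** The entropies are finite sums compared term by term, so equal sums force equality of each term,
    to which the equality case for one event applies. *)
Lemma cond_entropy_eqP : H W' = H W <->
  forall v, {ae P, forall x,
    cprob P W' (mv v) (W' x) = cprob P W (mv v) (W x)}.
Proof.
split=> [HE v|h]; last first.
  by apply: eq_bigr => v _; apply/(cond_entropy_term_eqP phi); exact: h.
apply/(cond_entropy_term_eqP phi).
pose a u := cond_entropy_term P W' (mv u).
pose b u := cond_entropy_term P W (mv u).
have afin u : a u = (fine (a u))%:E.
  by rewrite fineK// cond_entropy_term_fin_num.
have bfin u : b u = (fine (b u))%:E.
  by rewrite fineK// cond_entropy_term_fin_num.
have ab u : (0 <= fine (b u) - fine (a u))%R.
  by rewrite subr_ge0 -lee_fin -afin -bfin; exact: cond_entropy_term_le.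
have /eqP : (\sum_(u <- s) (fine (b u) - fine (a u)) = 0)%R.
  apply: EFin_inj; rewrite sumrB EFinB -!sumEFin.
  under eq_bigr do rewrite -bfin.
  under [X in _ - X]eq_bigr do rewrite -afin.
  transitivity (H W - H W'); first by [].
  by rewrite HE subee//; exact: cond_entropy_fin_num.
rewrite psumr_eq0; last by move=> u _; exact: ab.
move=> /allP/(_ v (s_full v)) /=; rewrite subr_eq0 => /eqP abv.
by rewrite -/(a v) -/(b v) afin bfin abv.
Qed.

End factor.

Section independence.
Context dU dW (TU : measurableType dU) (TW : measurableType dW).
Variables (U : {RV P >-> TU}) (W : {RV P >-> TW}).

(** Equality of entropies yields equal conditional probabilities for single values of [V];
    [cprob_sum] extends this to all measurable sets of values. *)
Lemma cond_indep_entropyP : cond_indep P U V W <-> H ⟨U, W⟩ = H W.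
Proof.
split=> [/cond_indepP h|/(cond_entropy_eqP (pair_rv_snd U W)) h].
  by apply/(cond_entropy_eqP (pair_rv_snd U W)) => v; exact: h.
apply/cond_indepP => C mC mVC.
have hW := ae_distribution (cprob_sum V s_uniq s_full m1 W mC).
have hUW := ae_distribution (cprob_sum (P := P) V s_uniq s_full m1 ⟨U, W⟩ mC).
apply: filterS3 hW hUW (ae_seq s h) => x <- <- e.
by rewrite !big_seq; apply: eq_bigr => v vs; rewrite e.
Qed.

End independence.
End discrete_conditional_entropy.

Section exchange.
Context d d1 d2 d3 (T : measurableType d) (T1 : measurableType d1)
  (T2 : measurableType d2) (T3 : measurableType d3) (R : realType).
Variables (P : probability T R).

Lemma pair_rv_exchange (U1 : {RV P >-> T1}) (U2 : {RV P >-> T2})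
    (W : {RV P >-> T3}) :
  exists2 f : T1 * (T2 * T3) -> T2 * (T1 * T3), measurable_fun setT f &
    forall x, ⟨U2, ⟨U1, W⟩⟩ x = f (⟨U1, ⟨U2, W⟩⟩ x).
Proof.
exists (fun z => (z.2.1, (z.1, z.2.2))) => //.
apply: measurable_fun_pair.
  exact: measurableT_comp measurable_fst measurable_snd.
apply: measurable_fun_pair => //.
exact: measurableT_comp measurable_snd measurable_snd.
Qed.

End exchange.

(** Each of the two triples is a measurable function of the other, so monotonicity applies in both
    directions. *)
Lemma cond_entropy_exchange d dV d1 d2 d3 (T : measurableType d)
    (TV : measurableType dV) (T1 : measurableType d1) (T2 : measurableType d2)
    (T3 : measurableType d3) (R : realType) (P : probability T R)
    (V : {RV P >-> TV}) (s : seq TV) (m1 : forall v : TV, measurable [set v])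
    (U1 : {RV P >-> T1}) (U2 : {RV P >-> T2}) (W : {RV P >-> T3}) :
  cond_entropy V s m1 ⟨U1, ⟨U2, W⟩⟩ = cond_entropy V s m1 ⟨U2, ⟨U1, W⟩⟩.
Proof.
by apply/eqP; rewrite eq_le; apply/andP; split;
  apply: cond_entropy_le; exact: pair_rv_exchange.
Qed.

Section sufficient_representation.
Context d dA dX dY dH (T : measurableType d) (TA : measurableType dA)
  (TX : measurableType dX) (TY : measurableType dY)
  (TH : measurableType dH) (R : realType) (P : probability T R).
Variables (A : {RV P >-> TA}) (X : {RV P >-> TX}) (Y : {RV P >-> TY})
  (HA : {RV P >-> TH}).
Variables (sA : seq TA) (sY : seq TY).
Hypotheses (sA_uniq : uniq sA) (sA_full : forall a, a \in sA).
Hypotheses (sY_uniq : uniq sY) (sY_full : forall y, y \in sY).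
Hypothesis mA : forall a : TA, measurable [set a].
Hypothesis mY : forall y : TY, measurable [set y].

(** After H(Y | A, X) is replaced by H(Y | A, HA, X), the equality of informations says that adding
    [A] to (HA, X) leaves the entropy of [Y] unchanged. *)
Lemma sufficiencyP : cond_indep P HA Y ⟨A, X⟩ ->
  cond_indep P Y A ⟨HA, X⟩ <->
    cond_mutual_info P HA Y X = cond_mutual_info P A Y X.
Proof.
move=> /(cond_indep_entropyP Y sY_uniq sY_full mY) HYE.
rewrite !(cond_mutual_infoE _ _ _ sY_uniq sY_full mY) -HYE cond_entropy_exchange.
split=> [/cond_indep_sym/(cond_indep_entropyP Y sY_uniq sY_full mY) ->//|e].
apply: cond_indep_sym; apply/(cond_indep_entropyP Y sY_uniq sY_full mY).
by apply/esym; apply: fin_num_subeI e; exact: cond_entropy_fin_num.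
Qed.

Lemma sufficient_information : cond_indep P Y A ⟨HA, X⟩ ->
  cond_mutual_info P A HA X >= cond_mutual_info P A Y X /\
  (cond_mutual_info P A HA X = cond_mutual_info P A Y X <->
    cond_mutual_info P A HA ⟨Y, X⟩ = 0).
Proof.
move=> /(cond_indep_entropyP A sA_uniq sA_full mA) HAE.
rewrite !(cond_mutual_info_swapE _ _ _ sA_uniq sA_full mA).
rewrite (cond_entropy_exchange A sA mA HA Y X) HAE.
(* Here a = H(A | X), b = H(A | HA, X) = H(A | HA, Y, X) and c = H(A | Y, X). *)
apply: fin_num_sube_gap; try exact: cond_entropy_fin_num.
rewrite -HAE -cond_entropy_exchange; apply: cond_entropy_le.
exact: pair_rv_snd.
Qed.

End sufficient_representation.

Theorem theorem17 (R : realType) (N C D p q : nat)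
    (d : measure_display) (T : measurableType d) (P : probability T R)
    (dE : measure_display) (E : measurableType dE)
    (A : {RV P >-> bool_matrix N}) (X : {RV P >-> real_matrix R N D})
    (Y : {RV P >-> label_vector N C}) (xi : {RV P >-> E})
    (HA : {RV P >-> real_matrix R p q})
    (h : {mfun (bool_matrix N * real_matrix R N D * E)%type
            >-> real_matrix R p q})
    (adjA : forall w, is_adjacency (A w))
    (HAE : forall w, HA w = h (A w, X w, xi w))
    (xi_indep : cond_indep P xi Y ⟨A, X⟩) :
  [/\ markov_chain P Y ⟨A, X⟩ HA,
      cond_indep P Y A ⟨HA, X⟩ <->
        cond_mutual_info P HA Y X = cond_mutual_info P A Y X &
      cond_indep P Y A ⟨HA, X⟩ /\
        cond_mutual_info P HA Y X = cond_mutual_info P A Y X ->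
      cond_mutual_info P A HA X >= cond_mutual_info P A Y X /\
      (cond_mutual_info P A HA X = cond_mutual_info P A Y X <->
        cond_mutual_info P A HA ⟨Y, X⟩ = 0)].
Proof.
have mA a : measurable [set a : bool_matrix N] by exact: sub_sigma_algebra.
have mY y : measurable [set y : label_vector N C] by exact: sub_sigma_algebra.
pose sA : seq (bool_matrix N) := enum 'M[bool]_N.
have uA : uniq sA by exact: (enum_uniq 'M[bool]_N).
have fA a : a \in sA by exact: (mem_enum 'M[bool]_N a).
pose sY : seq (label_vector N C) := enum 'rV['I_C.+1]_N.
have uY : uniq sY by exact: (enum_uniq 'rV['I_C.+1]_N).
have fY y : y \in sY by exact: (mem_enum 'rV['I_C.+1]_N y).
have HAY : cond_indep P HA Y ⟨A, X⟩.
  (* Given (A, X), the representation is a function of [xi] and (A, X), so it inherits the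
     independence of [xi] from [Y]; [k] only reorders the arguments of [h]. *)
  apply: (cond_indep_comp (k := fun z => h (z.2, z.1))) xi_indep => //.
  apply: measurableT_comp => //; exact: measurable_fun_pair.
split.
- exact: cond_indep_sym.
- exact: (sufficiencyP uY fY mY).
- by move=> [YA _]; exact: (sufficient_information uA fA mA).
Qed.
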